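(* Let $\epsilon>0$ be fixed and arbitrarily small, and let $p\in(0,1)$ be such that $\min\{|p-1/2|,\,1-p,\,p\}>\epsilon$. Then there exists a sequence of subsets $\mathcal{G}_n(p)$ of $\mathcal{G}_n$ such that, for any sequence $\{\alpha_n\}$ with $\alpha_n\in\mathbb{R}^{n-1}$ for all $n$ and $\|\alpha_n\|_\infty=o(n)$, $$\lim_{n\to\infty}P_p(\mathcal{G}_n(p))=1\quad\text{and}\quad\lim_{n\to\infty}P_{\alpha_n}(\mathcal{G}_n(p))=0.$$
   Context: $\mathcal{G}_n$ is the set of all simple undirected labelled graphs on $n$ nodes. For $g\in\mathcal{G}_n$, $n_k(g)$ is the number of nodes of $g$ of degree $k$. $P_p$ denotes the Erdős–Rényi distribution on $\mathcal{G}_n$ with parameter $p\in(0,1)$ (each of the $\binom n2$ edges is present independently with probability $p$). For $\alpha=(\alpha_1,\dots,\alpha_{n-1})\in\mathbb{R}^{n-1}$, $P_\alpha$ denotes the $1$K model on $\mathcal{G}_n$ with natural parameter $\alpha$, in the parametrization where $n_0$ is removed from the sufficient statistics: $P_\alpha(g)=\exp\{\sum_{i=1}^{n-1}\alpha_i n_i(g)\}\big/\sum_{h\in\mathcal{G}_n}\exp\{\sum_{i=1}^{n-1}\alpha_i n_i(h)\}$. *)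

(* Defs.v *)
From HB Require Import structures.
From mathcomp Require Import all_boot all_order all_algebra.
From mathcomp Require Import all_classical all_reals all_analysis.

Set Implicit Arguments.
Unset Strict Implicit.
Unset Printing Implicit Defensive.

Import Order.TTheory GRing.Theory Num.Theory.
Local Open Scope ring_scope.

Definition dyads (n : nat) : {set {set 'I_n}} := [set e : {set 'I_n} | #|e| == 2%N].

(* A simple undirected graph on the node set 'I_n, encoded by its edge set. *)
Definition graph (n : nat) : finType :=
  {g : {set {set 'I_n}} | g \subset dyads n}.

(* No loop is counted: for j = i the set [set i; j] has a single element. *)
Definition degree (n : nat) (g : graph n) (i : 'I_n) : nat :=
  #|[set j : 'I_n | [set i; j] \in val g]|.

Definition num_degree (n : nat) (k : nat) (g : graph n) : nat :=
  #|[set i : 'I_n | degree g i == k]|.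

Definition Prob (R : realType) (T : finType) (f : T -> R) (A : {set T}) : R :=
  \sum_(g in A) f g.

Definition erdos_renyi (R : realType) (n : nat) (p : R) (g : graph n) : R :=
  \prod_(e in dyads n) (if e \in val g then p else 1 - p).

(* Coordinates of alpha are indexed from 0: coordinate i is the natural
   parameter of the number of nodes of degree i + 1. *)
Definition one_k_weight (R : realType) (n : nat) (alpha : 'rV[R]_n.-1)
    (g : graph n) : R :=
  expR (\sum_(i < n.-1) alpha 0 i * (num_degree i.+1 g)%:R).

Definition one_k (R : realType) (n : nat) (alpha : 'rV[R]_n.-1)
    (g : graph n) : R :=
  one_k_weight alpha g / \sum_(h : graph n) one_k_weight alpha h.

(* Main.v *)
Require Import Defs.
From HB Require Import structures.
From mathcomp Require Import all_boot all_order all_algebra.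
From mathcomp Require Import all_classical all_reals all_analysis.
From mathcomp Require Import ring lra.

Set Implicit Arguments.
Unset Strict Implicit.
Unset Printing Implicit Defensive.

Import Order.TTheory GRing.Theory Num.Theory.
Import numFieldNormedType.Exports.
Local Open Scope classical_set_scope.
Local Open Scope ring_scope.

(** Let [N] be the number of dyads.  The affinity between the Erdos-Renyi and
the uniform measure on graphs is [sum_g sqrt (P_p g / 2^N) = rho ^ N] with
[rho = sqrt (p / 2) + sqrt ((1 - p) / 2)], and [rho < 1] because [p <> 1/2].
Hence for [G n = {g | 2^-N <= rho ^ N * P_p g}] the uniform probability of
[G n] and the [P_p]-probability of its complement are at most [rho ^ N] and
[rho ^ (N / 2)].  Since the degree counts sum to at most [n], the density of
[P_alpha] with respect to the uniform measure is at most
[exp (2 n |alpha|) = exp (o (n ^ 2))], which cannot compensate [rho ^ N]. *)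

Lemma card_dyads (n : nat) : #|dyads n| = 'C(n, 2).
Proof. by rewrite /dyads card_draws card_ord. Qed.

(** Binomial expansion of the product of [a + b] over dyads: each dyad chooses to be an edge or not.
    A semiring suffices, so the case of [nat] with [a = b = 1] counts the graphs. *)
Lemma sum_graph_prod (R : comPzSemiRingType) (n : nat) (a b : R) :
  \sum_(g : graph n) \prod_(e in dyads n) (if e \in val g then a else b) =
  (a + b) ^+ 'C(n, 2).
Proof.
rewrite -card_dyads.
(* Distributivity needs a product over all sets [e]. Non-dyads get the factor [0 + 1], which kills
   every edge set containing one of them. *)
have -> : (a + b) ^+ #|dyads n| =
    \prod_e ((if e \in dyads n then a else 0) + (if e \in dyads n then b else 1)).
  rewrite -prodr_const big_mkcond /=; apply: eq_bigr => e _.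
  by case: ifP => // _; rewrite add0r.
rewrite bigA_distr /= -(big_sub (mem [pred g : {set {set 'I_n}} | g \subset dyads n])
  (fun g => \prod_(e in dyads n) (if e \in g then a else b))) big_mkcond /=.
apply: eq_bigr => J _; rewrite unfold_in /=.
case: ifPn => [/fintype.subsetP sJ|/fintype.subsetPn [e eJ eD]].
  rewrite big_mkcond; apply: eq_bigr => e _.
  have [eJ|eJ] := boolP (e \in J); first by rewrite sJ.
  by case: ifP.
by rewrite (bigD1 e) //= eJ (negPf eD) mul0r.
Qed.

Lemma sum_erdos_renyi (R : realType) (n : nat) (p : R) :
  \sum_(g : graph n) erdos_renyi p g = 1.
Proof. by rewrite sum_graph_prod addrC subrK expr1n. Qed.

Lemma card_graph (n : nat) : #|graph n| = (2 ^ 'C(n, 2))%N.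
Proof.
rewrite -[RHS](sum_graph_prod n (1 : nat) 1) -sum1_card.
by apply: eq_bigr => g _; rewrite big1 // => e _; case: ifP.
Qed.

Section Affinity.
Variables (R : realType) (T : finType) (f u : T -> R) (r : R).
Hypotheses (f_ge0 : forall x, 0 <= f x) (u_ge0 : forall x, 0 <= u x).
Hypothesis r_ge0 : 0 <= r.

Let A := [set x : T | u x <= r ^+ 2 * f x]%SET.

Lemma sum_likelihood_set : \sum_(x in A) u x <= r ^+ 2 * \sum_x f x.
Proof.
rewrite mulr_sumr big_mkcond ler_sum // => x _.
by rewrite inE; case: ifP => // _; rewrite mulr_ge0 ?exprn_ge0.
Qed.

(** Markov-type bound: off [A], [r ^+ 2 * f x < u x], so [r * f x] is at most the geometric mean of
    [f x] and [u x]. *)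
Lemma sum_likelihood_setC :
  r * (\sum_x f x - \sum_(x in A) f x) <= \sum_x Num.sqrt (f x * u x).
Proof.
have -> : \sum_x f x - \sum_(x in A) f x = \sum_(x in ~: A) f x.
  rewrite (bigID (mem A)) /= addrAC subrr add0r.
  by apply: eq_bigl => x; rewrite !inE.
rewrite mulr_sumr big_mkcond ler_sum // => x _.
rewrite !inE -ltNge; case: ifP => [lt_fu|_]; last exact: sqrtr_ge0.
rewrite -[leLHS]ger0_norm ?mulr_ge0 // -sqrtr_sqr ler_wsqrtr //.
by rewrite exprMn [f x ^+ 2]expr2 mulrA mulrC ler_wpM2l // ltW.
Qed.

End Affinity.

(** The threshold is left as a square so that this is literally the set [A] above, with [u] the
    uniform mass and [r] the power of a square root. *)
Definition typical_graphs (R : realType) (p : R) (n : nat) : {set graph n} :=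
  [set g : graph n | 2^-1 ^+ 'C(n, 2) <=
    (Num.sqrt (Num.sqrt (p / 2) + Num.sqrt ((1 - p) / 2)) ^+ 'C(n, 2)) ^+ 2 *
    erdos_renyi p g]%SET.

Section TypicalGraphs.
Variables (R : realType) (p : R).
Hypotheses (p0 : 0 < p) (p1 : p < 1).

Let q0 : 0 < 1 - p. Proof. by rewrite subr_gt0. Qed.

Let rho := Num.sqrt (p / 2) + Num.sqrt ((1 - p) / 2).

Let rho_gt0 : 0 < rho.
Proof. by rewrite addr_gt0 // sqrtr_gt0 divr_gt0. Qed.

(** Since [x ^+ 2 + y ^+ 2 = 1 / 2], one has [(x + y) ^+ 2 = 1 - (x - y) ^+ 2], and [x = y] only at
    [p = 1 / 2]. *)
Lemma affinity_lt1 : p != 1 / 2 -> rho < 1.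
Proof.
move=> neq; set x := Num.sqrt (p / 2); set y := Num.sqrt ((1 - p) / 2).
have xE : x ^+ 2 = p / 2 by rewrite sqr_sqrtr // divr_ge0 // ltW.
have yE : y ^+ 2 = (1 - p) / 2 by rewrite sqr_sqrtr // divr_ge0 // ltW.
have xy : x != y.
  by apply: contra_neq neq => xy; move: xE; rewrite xy yE => h; lra.
have xy0 : 0 < (x - y) ^+ 2 by rewrite exprn_even_gt0 // subr_eq0.
rewrite -(@expr_lt1 _ 2) //; last exact: ltW.
by rewrite /rho -/x -/y; nra.
Qed.

Lemma erdos_renyi_ge0 (n : nat) (g : graph n) : 0 <= erdos_renyi p g.
Proof. by apply: prodr_ge0 => e _; case: ifP => _; exact: ltW. Qed.

(** The uniform mass is also a product over dyads, so the square root factors and [sum_graph_prod]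
    applies. *)
Lemma sum_sqrt_erdos_renyi (n : nat) :
  \sum_(g : graph n) Num.sqrt (erdos_renyi p g * 2^-1 ^+ 'C(n, 2)) =
  rho ^+ 'C(n, 2).
Proof.
rewrite -sum_graph_prod; apply: eq_bigr => g _.
rewrite -card_dyads -prodr_const -big_split /=.
have -> : \prod_(e in dyads n) ((if e \in val g then p else 1 - p) * 2^-1) =
    (\prod_(e in dyads n) (if e \in val g then Num.sqrt (p / 2)
       else Num.sqrt ((1 - p) / 2))) ^+ 2.
  rewrite -prodrXl; apply: eq_bigr => e _.
  by case: ifP => _; rewrite sqr_sqrtr // divr_ge0 // ltW.
rewrite sqrtr_sqr ger0_norm // prodr_ge0 // => e _.
by case: ifP => _; exact: sqrtr_ge0.
Qed.

Lemma card_typical_graphs (n : nat) :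
  #|typical_graphs p n|%:R <= (rho * 2) ^+ 'C(n, 2).
Proof.
have := @sum_likelihood_set R (graph n) (erdos_renyi p)
  (fun=> 2^-1 ^+ 'C(n, 2)) (Num.sqrt rho ^+ 'C(n, 2)) (@erdos_renyi_ge0 n).
rewrite sum_erdos_renyi mulr1 sumr_const => h.
rewrite exprMn -ler_pdivrMr ?exprn_gt0 // -exprVn mulrC mulr_natr.
apply: le_trans (h (exprn_ge0 _ (sqrtr_ge0 _))) _.
by rewrite -exprM mulnC exprM sqr_sqrtr // ltW.
Qed.

Lemma erdos_renyi_typical_graphs (n : nat) :
  1 - Num.sqrt rho ^+ 'C(n, 2) <= Prob (erdos_renyi p) (typical_graphs p n) <= 1.
Proof.
have r0 : 0 < Num.sqrt rho ^+ 'C(n, 2) by rewrite exprn_gt0 // sqrtr_gt0.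
apply/andP; split; last first.
  rewrite -[leRHS](sum_erdos_renyi n p) /Prob big_mkcond ler_sum // => g _.
  by case: ifP => // _; exact: erdos_renyi_ge0.
have := @sum_likelihood_setC R (graph n) (erdos_renyi p)
  (fun=> 2^-1 ^+ 'C(n, 2)) (Num.sqrt rho ^+ 'C(n, 2)) (@erdos_renyi_ge0 n).
move=> /(_ (ltW r0)).
rewrite sum_erdos_renyi sum_sqrt_erdos_renyi.
(* The affinity is the square of the factor on the left; cancelling it once leaves the bound on the
   complement. *)
have -> : rho ^+ 'C(n, 2) = Num.sqrt rho ^+ 'C(n, 2) * Num.sqrt rho ^+ 'C(n, 2).
  by rewrite -exprMn -expr2 sqr_sqrtr // ltW.
rewrite ler_pM2l // => h.
by rewrite lerBlDl -lerBlDr.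
Qed.

End TypicalGraphs.

(** Double counting: a vertex has a single degree, so it enters at most one of the counts, and none
    if it is isolated. *)
Lemma sum_num_degree (n : nat) (g : graph n) :
  (\sum_(i < n.-1) num_degree i.+1 g <= n)%N.
Proof.
rewrite /num_degree.
under eq_bigr do rewrite -sum1dep_card big_mkcond.
rewrite exchange_big /= -[leqRHS]card_ord -sum1_card leq_sum // => v _.
rewrite -big_mkcond /= sum1_card; apply/card_le1_eqP => i j.
by rewrite !unfold_in => /eqP -> /eqP [] /val_inj.
Qed.

Lemma ler_mx_norm_coord (R : realType) (m n : nat) (x : 'M[R]_(m, n)) i j :
  `|x i j| <= `|x|.
Proof.
rewrite [leRHS]/Num.Def.normr /= mx_normrE.
exact: (le_bigmax _ (fun ij : 'I_m * 'I_n => `|x ij.1 ij.2|) (i, j)).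
Qed.

Section OneK.
Variables (R : realType) (n : nat) (alpha : 'rV[R]_n.-1).

Lemma one_k_weight_bounds (g : graph n) :
  expR (- (`|alpha| * n%:R)) <= one_k_weight alpha g <= expR (`|alpha| * n%:R).
Proof.
rewrite !ler_expR -ler_norml (le_trans (ler_norm_sum _ _ _)) //.
apply: (@le_trans _ _ (\sum_(i < n.-1) `|alpha| * (num_degree i.+1 g)%:R)).
  by apply: ler_sum => i _; rewrite normrM ler_pM // ?ler_mx_norm_coord ?normr_nat.
by rewrite -mulr_sumr -natr_sum ler_wpM2l // ler_nat sum_num_degree.
Qed.

Lemma one_k_ge0 (A : {set graph n}) : 0 <= Prob (one_k alpha) A.
Proof.
apply: sumr_ge0 => g _; rewrite divr_ge0 ?expR_ge0 //.
by apply: sumr_ge0 => h _; exact: expR_ge0.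
Qed.

(** One factor [expR M] bounds the weights in the numerator; the other comes from the normalizer,
    where each graph weighs at least [expR (- M)]. *)
Lemma one_k_le_uniform (A : {set graph n}) :
  Prob (one_k alpha) A <=
  expR (`|alpha| * n%:R) ^+ 2 * (#|A|%:R / 2 ^+ 'C(n, 2)).
Proof.
rewrite /Prob /one_k -mulr_suml.
set M := `|alpha| * n%:R.
have Z : 2 ^+ 'C(n, 2) * expR (- M) <= \sum_(h : graph n) one_k_weight alpha h.
  rewrite -natrX -card_graph mulr_natl -sumr_const ler_sum // => h _.
  by have /andP[] := one_k_weight_bounds h.
have Z0 : 0 < 2 ^+ 'C(n, 2) * expR (- M) by rewrite mulr_gt0 ?exprn_gt0 ?expR_gt0.
rewrite ler_pdivrMr ?(lt_le_trans Z0) //.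
apply: (@le_trans _ _ (#|A|%:R * expR M)).
  rewrite mulr_natl -sumr_const ler_sum // => g _.
  by have /andP[] := one_k_weight_bounds g.
have -> : #|A|%:R * expR M = expR M ^+ 2 * (#|A|%:R / 2 ^+ 'C(n, 2)) *
    (2 ^+ 'C(n, 2) * expR (- M)).
  by rewrite expRN; field; rewrite gt_eqF ?expR_gt0 // gt_eqF // exprn_gt0.
by rewrite ler_wpM2l // mulr_ge0 ?exprn_ge0 ?expR_ge0 ?divr_ge0.
Qed.

End OneK.

Lemma leq_bin2 (n : nat) : (3 <= n)%N -> (n <= 'C(n, 2))%N.
Proof.
case: n => [//|n] n2.
by rewrite -(leq_pmul2l (ltn0Sn 1)) -mul_bin_diag bin1 mulnC leq_mul2l.
Qed.

Lemma sqr_le_bin2 (n : nat) : (2 <= n)%N -> (n * n <= 4 * 'C(n, 2))%N.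
Proof.
case: n => [//|n] n1.
rewrite -[4%N]/(2 * 2)%N -mulnA -mul_bin_diag bin1 mulnCA leq_mul2l /=.
by rewrite mul2n -addnn -addn1 leq_add2l.
Qed.

(** The exponent is at least [n] from [n = 3] on, so the geometric sequence dominates. *)
Lemma cvg_expr_bin2 (R : realType) (z : R) : 0 <= z -> z < 1 ->
  z ^+ 'C(n, 2) @[n --> \oo] --> (0 : R).
Proof.
move=> z0 z1; apply: (@squeeze_cvgr _ _ _ _ (cst 0) (fun n => z ^+ n)).
- near=> n; rewrite exprn_ge0 //=; apply: ler_wiXn2l (ltW z1) _ _ _ => //.
  by apply: leq_bin2; near: n; exact: nbhs_infty_ge.
- exact: cvg_cst.
- by apply: cvg_expr; rewrite ger0_norm.
Unshelve. all: by end_near. Qed.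

Theorem proposition6 (R : realType) (eps p : R) (heps : 0 < eps)
    (hp0 : 0 < p) (hp1 : p < 1)
    (hp : eps < Num.min `|p - 1 / 2| (Num.min (1 - p) p)) :
  exists G : forall n : nat, {set graph n},
  forall alpha : forall n : nat, 'rV[R]_n.-1,
    (fun n : nat => `|alpha n| : R^o) =o_\oo (fun n : nat => n%:R : R^o) ->
    (Prob (erdos_renyi p) (G n) @[n --> \oo] --> (1 : R)) /\
    (Prob (one_k (alpha n)) (G n) @[n --> \oo] --> (0 : R)).
Proof.
exists (typical_graphs p) => alpha alpha_o.
have p_half : p != 1 / 2.
  rewrite -subr_eq0 -normr_gt0; apply: lt_trans heps _.
  by move: hp; rewrite lt_min => /andP[].
have := affinity_lt1 hp0 hp1 p_half.
have typ n := erdos_renyi_typical_graphs hp0 hp1 n.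
have card_typ n := card_typical_graphs hp0 hp1 n.
set rho := Num.sqrt (p / 2) + _ in typ card_typ * => rho1.
have rho0 : 0 < rho by rewrite addr_gt0 // sqrtr_gt0 divr_gt0 // subr_gt0.
set r := Num.sqrt rho in typ.
have r0 : 0 < r by rewrite sqrtr_gt0.
have r1 : r < 1 by rewrite -sqrtr1 ltr_sqrt.
have cvg_r := cvg_expr_bin2 (ltW r0) r1.
split.
  apply: (@squeeze_cvgr _ _ _ _ (fun n => 1 - r ^+ 'C(n, 2)) (cst 1)).
  - by near=> n; exact: typ.
  - by rewrite -[X in _ --> X]subr0; apply: cvgB => //; exact: cvg_cst.
  - exact: cvg_cst.
(* This slope lets the density grow only like [r^-1 ^+ 'C(n, 2)]. The uniform mass decays like
   [(r * r) ^+ 'C(n, 2)], so one factor [r] per dyad survives. *)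
pose d := - ln r / 8.
have d0 : 0 < d by rewrite divr_gt0 // oppr_gt0 ln_lt0 // r0.
apply: (@squeeze_cvgr _ _ _ _ (cst 0) (fun n => r ^+ 'C(n, 2))) => //;
  last exact: cvg_cst.
move/eqoP : alpha_o => /(_ d d0) alpha_o.
near=> n; rewrite one_k_ge0 /=.
have n2 : (2 <= n)%N by near: n; exact: nbhs_infty_ge.
have alpha_le : `|alpha n| <= d * n%:R.
  rewrite -[leLHS]normr_id -(normr_nat R n).
  by near: n; exact: alpha_o.
apply: le_trans (one_k_le_uniform _ _) _.
(* [2 n |alpha n| <= 2 d n^2 <= 8 d N = - ln r * N], and [rho = r ^ 2]. *)
have weight_le : expR (`|alpha n| * n%:R) ^+ 2 <= r^-1 ^+ 'C(n, 2).
  rewrite -expRM_natl -[r^-1](lnK _) ?posrE ?invr_gt0 // -expRM_natl ler_expR.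
  rewrite lnV ?posrE //.
  have -> : - ln r = d * 8 by rewrite /d; field.
  have nn : n%:R * n%:R <= 4 * 'C(n, 2)%:R :> R.
    by rewrite -!natrM ler_nat sqr_le_bin2.
  have : `|alpha n| * n%:R <= d * n%:R * n%:R by rewrite ler_wpM2r.
  have : d * (n%:R * n%:R) <= d * (4 * 'C(n, 2)%:R) by rewrite ler_wpM2l // ltW.
  lra.
have unif_le : #|typical_graphs p n|%:R / 2 ^+ 'C(n, 2) <= (r * r) ^+ 'C(n, 2).
  by rewrite ler_pdivrMr ?exprn_gt0 // -exprMn -expr2 sqr_sqrtr // ltW.
apply: le_trans (ler_pM _ _ weight_le unif_le) _.
- by rewrite exprn_ge0 // expR_ge0.
- by rewrite divr_ge0.
- by rewrite -exprMn mulKf // gt_eqF.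
Unshelve. all: by end_near. Qed.
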